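(* For every nonnegative integer $m$ and every permutation $\tau$ of $\{0,1,\ldots,m\}$, $$\sum_{i,j=0}^{m}[i,j]_m\,[\tau(i),\tau(j)]_m \;\ge\; \binom{2m+1}{m}^2.$$
   Context: For integers $0\le i,j\le m$, define $$[i,j]_m=\binom{i+j}{i}\binom{2m-i-j}{m-i}.$$ The sum $\sum_{i,j=0}^m$ runs over all pairs $(i,j)$ with $0\le i\le m$ and $0\le j\le m$. *)

(* Defs.v *)
From mathcomp Require Import all_boot all_fingroup.

Set Implicit Arguments.
Unset Strict Implicit.
Unset Printing Implicit Defensive.

(* Meant for i, j <= m, where none of the subtractions truncates. *)
Definition bracket (m i j : nat) : nat :=
  'C(i + j, i) * 'C(2 * m - i - j, m - i).

(* Main.v *)
Require Import Defs.
From mathcomp Require Import all_boot all_fingroup.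
From mathcomp Require Import zify.

(** By Vandermonde, [C(i+j, i) = \sum_k C(i, k) C(j, k)], so the matrix
    [A i j = bracket m i j] is a Gram matrix; its rows all have the same sum
    [S = C(2m+1, m)].  For any Gram matrix [A i j = \sum_p u_p(i) u_p(j)] of
    order [n] with constant row sum [S], put [M_pq = \sum_i u_p(i) u_q(tau i)]
    and [a_p = \sum_i u_p(i)].  Then
    [\sum_(i, j) A i j * A (tau i) (tau j) = \sum_(p, q) M_pq ^ 2],
    [\sum_(p, q) M_pq a_p a_q = n S ^ 2] and [\sum_p a_p ^ 2 = n S], and
    [\sum_(p, q) (n M_pq - a_p a_q) ^ 2 >= 0] is the desired inequality. *)

Lemma sqr_sum (I : finType) (F : I -> nat) :
  (\sum_i F i) ^ 2 = \sum_i \sum_j F i * F j.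
Proof. by rewrite -mulnn big_distrlr. Qed.

Section GramMatrix.
Variables (I P : finType) (u : P -> I -> nat) (S : nat) (tau : {perm I}).
Let A i j := \sum_p u p i * u p j.
Let a p := \sum_i u p i.
Let M p q := \sum_i u p i * u q (tau i).
Hypothesis rowA : forall i, \sum_j A i j = S.

Lemma gram_mulE :
  \sum_i \sum_j A i j * A (tau i) (tau j) = \sum_p \sum_q M p q ^ 2.
Proof.
under [RHS]eq_bigr => p _.
  under eq_bigr => q _ do rewrite sqr_sum.
  rewrite exchange_big; under eq_bigr => i _ do rewrite exchange_big.
  over.
rewrite [RHS]exchange_big; apply: eq_bigr => i _.
rewrite [RHS]exchange_big; apply: eq_bigr => j _.
rewrite big_distrlr; apply: eq_bigr => p _; apply: eq_bigr => q _ /=.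
by rewrite mulnACA.
Qed.

Lemma gram_row i : \sum_p u p i * a p = S.
Proof.
rewrite -(rowA i) exchange_big; apply: eq_bigr => p _.
by rewrite big_distrr.
Qed.

Lemma gram_sum_sqr : \sum_p a p ^ 2 = #|I| * S.
Proof.
under eq_bigr => p _ do rewrite -mulnn {1}/a big_distrl.
rewrite exchange_big -sum_nat_const.
by apply: eq_bigr => i _; rewrite gram_row.
Qed.

(** For each fixed [i] the sum over [p, q] factors into the [gram_row] sums at [i] and at [tau i],
    both equal to [S]. *)
Lemma gram_cross : \sum_p \sum_q M p q * (a p * a q) = #|I| * S ^ 2.
Proof.
rewrite -sum_nat_const.
under eq_bigr => p _.
  under eq_bigr => q _ do rewrite big_distrl.
  rewrite exchange_big; over.
rewrite exchange_big; apply: eq_bigr => i _.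
rewrite -mulnn -{1}(gram_row i) -(gram_row (tau i)) big_distrlr.
by apply: eq_bigr => p _; apply: eq_bigr => q _ /=; rewrite mulnACA.
Qed.

Lemma gram_perm_ge : 0 < #|I| ->
  S ^ 2 <= \sum_i \sum_j A i j * A (tau i) (tau j).
Proof.
rewrite gram_mulE => n_gt0; set n := #|I| in n_gt0; set T := \sum_p _.
(* The nonnegative square, written as [2xy <= x^2 + y^2] to avoid truncated subtraction. *)
have le : \sum_p \sum_q 2 * (n * M p q * (a p * a q)) <=
          \sum_p \sum_q ((n * M p q) ^ 2 + (a p * a q) ^ 2).
  by apply: leq_sum => p _; apply: leq_sum => q _; rewrite nat_Cauchy.
have lhsE : \sum_p \sum_q 2 * (n * M p q * (a p * a q)) = 2 * (n * (n * S ^ 2)).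
  rewrite -gram_cross mulnA big_distrr; apply: eq_bigr => p _ /=.
  by rewrite big_distrr; apply: eq_bigr => q _ /=; rewrite !mulnA.
have rhsE : \sum_p \sum_q ((n * M p q) ^ 2 + (a p * a q) ^ 2) =
            n ^ 2 * T + (n * S) ^ 2.
  rewrite -{1}gram_sum_sqr sqr_sum big_distrr -big_split.
  apply: eq_bigr => p _ /=; rewrite big_distrr -big_split.
  by apply: eq_bigr => q _ /=; rewrite !expnMn.
have n2_gt0 : 0 < n ^ 2 by rewrite expn_gt0 n_gt0.
(* [le] now reads [2 n^2 S^2 <= n^2 T + n^2 S^2]. *)
move: le; rewrite lhsE rhsE expnMn (mulnA n n) mulnn mul2n -addnn leq_add2r.
by rewrite leq_pmul2l.
Qed.

End GramMatrix.

(** Coefficient of [x^m] in [(1-x)^-(a+1) * (1-x)^-(b+1) = (1-x)^-(a+b+2)], proved by induction on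
    [a], then [m]. *)
Lemma sum_bin_upper (a b m : nat) :
  \sum_(j < m.+1) 'C(a + j, a) * 'C(b + (m - j), b) = 'C(a + b + m.+1, m).
Proof.
elim: a m => [|a IHa] m.
  elim: m => [|m IHm]; first by rewrite big_ord1 !addn0 !binn bin0.
  rewrite big_ord_recl /= !bin0 mul1n subn0.
  under eq_bigr => j _ do rewrite /bump add1n subSS bin0 -(bin0 (0 + j)).
  move: IHm; rewrite !add0n => ->.
  by rewrite [in RHS]addnS binS -[in LHS](bin_sub (leq_addr _ b)) addKn.
elim: m => [|m IHm]; first by rewrite big_ord1 !addn0 !binn bin0.
have -> : a.+1 + b + m.+2 = (a + b + m.+2).+1 by lia.
(* Pascal's rule on the right gives the sums for [(a, m.+1)] and [(a.+1, m)]; after peeling off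
   [j = 0], Pascal's rule matches them termwise with the left. *)
rewrite binS -IHa.
have -> : a + b + m.+2 = a.+1 + b + m.+1 by lia.
rewrite -IHm [in LHS]big_ord_recl [X in _ = X + _]big_ord_recl /= !addn0 !binn.
rewrite -addnA; congr (_ + _); rewrite -big_split; apply: eq_bigr => j _ /=.
rewrite /bump add1n subSS -mulnDl; congr (_ * _).
by rewrite addSn binS addnC addSnnS addnC.
Qed.

(** Terms with [k > i] vanish; the common bound [m] gives all Gram vectors one index set. *)
Lemma sum_bin_mul_bin (m i j : nat) : i <= m ->
  \sum_(k < m.+1) 'C(i, k) * 'C(j, k) = 'C(i + j, i).
Proof.
move=> le_im; rewrite addnC -binomial.Vandermonde.
rewrite (big_ord_widen m.+1 (fun k => 'C(j, k) * 'C(i, i - k))) // [RHS]big_mkcond.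
apply: eq_bigr => k _ /=; case: ltnP => [lt_ki | lt_ik].
  by rewrite bin_sub // mulnC.
by rewrite bin_small.
Qed.

Lemma bracket_gram (m i j : nat) : i <= m -> j <= m ->
  bracket m i j = \sum_(p : 'I_m.+1 * 'I_m.+1)
    ('C(i, p.1) * 'C(m - i, p.2)) * ('C(j, p.1) * 'C(m - j, p.2)).
Proof.
move=> le_im le_jm; rewrite /bracket.
have -> : 2 * m - i - j = (m - i) + (m - j) by lia.
rewrite -(sum_bin_mul_bin m i j) // -(sum_bin_mul_bin m) ?leq_subr //.
rewrite big_distrlr pair_bigA; apply: eq_bigr => p _ /=.
by rewrite mulnACA.
Qed.

(** This is [sum_bin_upper] with [a = i] and [b = m - i]: only [a + b = m] enters the result, hence
    the same sum in every row. *)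
Lemma bracket_row_sum (m i : nat) : i <= m ->
  \sum_(j < m.+1) bracket m i j = 'C(2 * m + 1, m).
Proof.
move=> le_im; have -> : 2 * m + 1 = i + (m - i) + m.+1 by lia.
rewrite -sum_bin_upper; apply: eq_bigr => j _; rewrite /bracket.
by congr (_ * 'C(_, _)); have := ltn_ord j; lia.
Qed.

Theorem theorem1 (m : nat) (tau : 'S_m.+1) :
  'C(2 * m + 1, m) ^ 2 <=
    \sum_(i < m.+1) \sum_(j < m.+1) bracket m i j * bracket m (tau i) (tau j).
Proof.
pose u (p : 'I_m.+1 * 'I_m.+1) (i : 'I_m.+1) := 'C(i, p.1) * 'C(m - i, p.2).
have gramE (i j : 'I_m.+1) : bracket m i j = \sum_p u p i * u p j.
  by apply: bracket_gram; rewrite -ltnS.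
under eq_bigr => i _ do under eq_bigr => j _ do rewrite !gramE.
apply: gram_perm_ge; last by rewrite card_ord.
move=> i; under eq_bigr => j _ do rewrite -gramE.
by apply: bracket_row_sum; rewrite -ltnS.
Qed.
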